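(* Let $0<\mu<b$, $0\le d\le\frac{2\mu(b-\mu)}{b}$, $m>0$ and $z\in[0,b]$. If $z+m\le b$, then $$\sup_{\mathbb{P}\in\mathcal{P}_{(\mu,b,d)}}\mathbb{E}_{\mathbb{P}}[\phi(z,S)]=\begin{cases}\min\Big\{m,\ \frac{m}{m+z}\Big(\mu-\frac{d(b-(m+z))}{2(b-\mu)}\Big)\Big\}, & \text{if } z\le m+z\le\mu,\\[4pt] \min\Big\{m\big(1-\frac{d}{2\mu}\big),\ z\big(\frac{d}{2\mu}-1\big)+\mu\Big\}, & \text{if } z\le\mu\le z+m\le b,\\[4pt] \min\Big\{m\big(1-\frac{d}{2\mu}\big),\ \frac{dm}{2(m+z-\mu)}\Big\}, & \text{if } \mu\le z\le z+m\le b.\end{cases}$$ If $z+m>b$, in which case $\phi(z,S)$ reduces to $\max\{S-z,0\}$, then $$\sup_{\mathbb{P}\in\mathcal{P}_{(\mu,b,d)}}\mathbb{E}_{\mathbb{P}}[\phi(z,S)]=\begin{cases} z\big(\frac{d}{2\mu}-1\big)+\mu, & \text{if } z\le\mu,\\[4pt] \frac{d(b-z)}{2(b-\mu)}, & \text{if } z\ge\mu.\end{cases}$$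
   Context: $\mathcal{P}_{(\mu,b,d)}$ is the set of all Borel probability measures $\mathbb{P}$ (the distribution of the total claim $S$) such that $\mathbb{P}(S\in[0,b])=1$, $\mathbb{E}_{\mathbb{P}}[S]=\mu$ and $\mathbb{E}_{\mathbb{P}}[|S-\mu|]=d$. The function $\phi$ (the payment of the reinsurer with retention limit $z$ and maximum payment $m$) is $$\phi(z,S)=\begin{cases} m, & S\ge z+m,\\ S-z, & z\le S\le z+m,\\ 0, & S\le z.\end{cases}$$ *)

(* Defs.v *)
From mathcomp Require Import all_boot all_order all_algebra.
From mathcomp Require Import all_classical all_reals all_analysis.
Set Implicit Arguments.
Unset Strict Implicit.
Unset Printing Implicit Defensive.
Import Order.TTheory GRing.Theory Num.Theory.
Import numFieldNormedType.Exports.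
Local Open Scope classical_set_scope.
Local Open Scope ring_scope.

(* Retention limit z, maximum payment m. For m >= 0 the three cases agree
   where they overlap, so the order of the tests is immaterial. *)
Definition phi (R : realType) (m z s : R) : R :=
  if z + m <= s then m else if z <= s then s - z else 0.

(* The Borel probability measures are the distributions of S, so S is the
   identity on the line. The two moments are extended-real integrals; since
   P is concentrated on [0, b] their integrands are P-integrable. *)
Definition ambiguity_set (R : realType) (mu b d : R) :
    set (probability (measurableTypeR R) R) :=
  [set P : probability (measurableTypeR R) R |
    [/\ P `[0, b]%classic = 1%E,
        ('E_P[(fun s : R => s)] = mu%:E)%E
      & ('E_P[(fun s : R => `|s - mu|%R)] = d%:E)%E]].

(* -oo on an empty ambiguity set. *)
Definition worst_case (R : realType) (mu b d : R) (f : R -> R) : \bar R :=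
  ereal_sup [set ('E_P[f])%E | P in ambiguity_set mu b d].

(* Main.v *)
From HB Require Import structures.
Require Import Defs.
From mathcomp Require Import all_boot all_order all_algebra.
From mathcomp Require Import all_classical all_reals all_analysis.
From mathcomp Require Import measurable_realfun.
From mathcomp Require Import ring lra.
Set Implicit Arguments.
Unset Strict Implicit.
Unset Printing Implicit Defensive.
Import Order.TTheory GRing.Theory Num.Theory.
Import numFieldNormedType.Exports.
Local Open Scope classical_set_scope.
Local Open Scope ring_scope.

(** Worst-case expected payment of a layer under mean and mean absolute
deviation information: a linear programming duality argument.

Since the mean is mu, prescribing E|S - mu| = d is the same as prescribing
E(S - mu)^+ = d/2. Hence every function that is affine on [0, mu] and on
[mu, b], continuous at mu, with slopes alpha and beta, has the same expectation
F(mu) + (beta - alpha) d/2 under all admissible laws, where F(mu) is its value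
at the kink; if it dominates phi on [0, b], that expectation is an upper bound
([worst_case_le_kinked]). Conversely any admissible law bounds the supremum
from below, and laws with at most three atoms are enough
([le_worst_case_three_atoms]).

Which kinked majorants are tight depends on the position of the layer
[z, z + m] relative to mu:
- the constant m, attained when an admissible law lives on [z + m, b];
- for z + m <= mu, the chord of phi through (0, 0) and (z + m, m), extended to
  mu and then joined to (b, m); it is touched at 0, z + m and b;
- for mu <= z + m, the line from (0, 0) to (mu, m) followed by the constant m;
- for z <= mu, the line from (0, 0) to (mu, mu - z) followed by s - z;
- for mu <= z, zero up to mu followed by the chord from (mu, 0) to the end of
  the layer (or to (b, b - z) when the layer sticks out of [0, b]).
The law with atoms 0 and y = mu / (1 - d / (2 mu)) is admissible and, when
mu <= z + m, settles most cases: it lives on the contact set of the third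
majorant if y >= z + m and, for z <= mu, on that of the fourth one if
y <= z + m. In the remaining cases, with mu <= z, mass is moved from y to mu and
to the right end of the chord. The upper bound on d is what makes y <= b and all
weights nonnegative. *)

(** * Laws with three atoms *)

(** The complement of [D] is negligible. This turns expectations of functions
that are only controlled on the support, such as the identity on [0, b], into
integrals of nonnegative functions. *)
Lemma expectation_concentrated (d : measure_display) (T : measurableType d)
    (R : realType) (P : probability T R) (D : set T) (f : T -> R) :
  measurable D -> P D = 1%E -> measurable_fun [set: T] f ->
  ('E_P[f] = \int[P]_(x in D) (f x)%:E)%E.
Proof.
move=> mD PD /measurable_EFinP mf; rewrite unlock [RHS]integral_mkcond.
apply: ae_eq_integral => //.
- by apply: (measurable_restrictT _ mD).1; exact: measurable_funTS.
- exists (~` D); split.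
  + exact: measurableC.
  + by have := probability_setC P mD; rewrite PD subee.
  + by move=> x /=; apply: contra_not => xD _; rewrite patchE mem_set.
Qed.

Section three_atoms.
Context (dsp : measure_display) (T : measurableType dsp) (R : realType).
Variables (p q r : {nonneg R}) (x y w : T).

Definition three_atoms : set T -> \bar R :=
  measure_add (mscale p \d_x) (measure_add (mscale q \d_y) (mscale r \d_w)).

HB.instance Definition _ := Measure.on three_atoms.

Lemma three_atomsE A : three_atoms A =
  (p%:num%:E * \d_x A + (q%:num%:E * \d_y A + r%:num%:E * \d_w A))%E.
Proof. by rewrite /three_atoms measure_addE [X in (_ + X)%E]measure_addE. Qed.

Lemma three_atoms_concentrated (D : set T) :
  D x -> D y -> D w -> p%:num + q%:num + r%:num = 1 ->
  three_atoms D = 1%E.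
Proof.
move=> Dx Dy Dw pqr.
by rewrite three_atomsE !diracE !mem_set// !mule1 -!EFinD addrA pqr.
Qed.

Lemma integral_three_atoms (D : set T) (f : T -> R) :
  measurable D -> D x -> D y -> D w ->
  measurable_fun [set: T] f ->
  (forall s, D s -> 0 <= f s) ->
  (\int[three_atoms]_(s in D) (f s)%:E =
   (p%:num * f x + q%:num * f y + r%:num * f w)%:E)%E.
Proof.
move=> mD Dx Dy Dw mf f0.
have mfD : measurable_fun D (EFin \o f).
  by apply/measurable_EFinP; exact: measurable_funTS.
have f0' s : D s -> (0 <= (f s)%:E)%E by move=> /f0; rewrite lee_fin.
rewrite ge0_integral_measure_add// ge0_integral_measure_add//.
rewrite !ge0_integral_mscale// !integral_dirac//.
by rewrite !diracE !mem_set// !mul1e -!EFinM -!EFinD addrA.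
Qed.

End three_atoms.
Arguments three_atoms {dsp T R}.

Lemma three_atoms_law (dsp : measure_display) (T : measurableType dsp)
    (R : realType) (p q r : R) (x y w : T) (D : set T) :
  0 <= p -> 0 <= q -> 0 <= r -> p + q + r = 1 ->
  measurable D -> D x -> D y -> D w ->
  exists P : probability T R, P D = 1%E /\
    forall f : T -> R, measurable_fun [set: T] f ->
      (forall s, D s -> 0 <= f s) ->
      ('E_P[f] = (p * f x + q * f y + r * f w)%:E)%E.
Proof.
move=> p0 q0 r0 pqr mD Dx Dy Dw.
pose M := three_atoms (NngNum p0) (NngNum q0) (NngNum r0) x y w.
have MT : M setT = 1%E by exact: three_atoms_concentrated.
pose H := Measure_isProbability.Build _ _ _ M MT.
pose P : probability T R := HB.pack M H.
have PD : P D = 1%E by exact: three_atoms_concentrated.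
exists P; split=> // f mf f0.
rewrite (expectation_concentrated mD PD mf).
exact: (@integral_three_atoms _ _ _ (NngNum p0) (NngNum q0) (NngNum r0)).
Qed.

(** * Bounds on the worst case by duality *)

(** With [x] and [y] left of the mean and [w] right of it, the deviation
constraint only involves [w], because the positive and negative parts of
S - mu have the same expectation. The slack [v] leaves room for bounding by one
of the terms of a minimum. *)
Lemma le_worst_case_three_atoms (R : realType) (mu b d : R) (f : R -> R)
    (p q r x y w v : R) :
  measurable_fun [set: measurableTypeR R] f ->
  (forall s : R, 0 <= s <= b -> 0 <= f s) ->
  0 <= x <= mu -> 0 <= y <= mu -> mu <= w <= b ->
  0 <= p -> 0 <= q -> 0 <= r -> p + q + r = 1 ->
  p * x + q * y + r * w = mu -> r * (w - mu) = d / 2 ->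
  v <= p * f x + q * f y + r * f w ->
  (v%:E <= worst_case mu b d f)%E.
Proof.
move=> mf f0 /andP[x0 xmu] /andP[y0 ymu] /andP[muw wb] p0 q0 r0 pqr mean dev.
rewrite -lee_fin => /le_trans; apply.
have mI : measurable (`[0%R, b]%classic : set (measurableTypeR R)).
  exact: measurable_itv.
have inI (s : R) : 0 <= s -> s <= b -> `[0, b]%classic s.
  by move=> s0 sb; rewrite /= in_itv/= s0.
have [P [Pb EP]] := @three_atoms_law _ (measurableTypeR R) R p q r x y w _
  p0 q0 r0 pqr mI (inI x x0 (le_trans xmu (le_trans muw wb)))
  (inI y y0 (le_trans ymu (le_trans muw wb)))
  (inI w (le_trans x0 (le_trans xmu muw)) wb).
rewrite -EP//; rewrite /worst_case; apply: ereal_sup_ubound; exists P => //.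
split=> //; first by rewrite EP ?mean// => s /andP[].
rewrite EP//; last first.
  by apply: measurableT_comp => //; exact: measurable_funB.
congr EFin.
rewrite (ler0_norm (_ : x - mu <= 0)) ?subr_le0//.
rewrite (ler0_norm (_ : y - mu <= 0)) ?subr_le0//.
by rewrite (ger0_norm (_ : 0 <= w - mu)) ?subr_ge0//; nra.
Qed.

(** Weak duality. The kinked line equals a combination of 1, s and |s - mu|,
whose expectations are prescribed. *)
Lemma worst_case_le_kinked (R : realType) (mu b d : R) (f : R -> R)
    (c alpha beta : R) :
  measurable_fun [set: measurableTypeR R] f ->
  (forall s : R, 0 <= s <= b -> 0 <= f s) ->
  (forall s : R, 0 <= s <= mu -> f s <= c + alpha * s) ->
  (forall s : R, mu <= s <= b -> f s <= c + alpha * mu + beta * (s - mu)) ->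
  (worst_case mu b d f <= (c + alpha * mu + (beta - alpha) * (d / 2))%:E)%E.
Proof.
move=> mf f0 fl fr; rewrite /worst_case.
apply: ge_ereal_sup => _ [P [Pb mean dev] <-].
set g := fun s : R => `|s - mu|.
have mg : measurable_fun [set: measurableTypeR R] g.
  by apply: measurableT_comp => //; exact: measurable_funB.
have mI : measurable (`[0%R, b]%classic : set (measurableTypeR R)).
  exact: measurable_itv.
rewrite (@expectation_concentrated _ _ _ _ _ _ mI Pb mf).
move: mean dev; rewrite (@expectation_concentrated _ _ _ _ _ _ mI Pb mg).
rewrite (@expectation_concentrated _ _ _ _ _ _ mI Pb (@measurable_id _ _ _)).
move=> mean dev.
have integ (h : R -> R) (e : R) : measurable_fun [set: measurableTypeR R] h ->
    (forall s : R, 0 <= s <= b -> 0 <= h s) ->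
    (\int[P]_(x in `[0%R, b]) (h x)%:E = e%:E)%E ->
    P.-integrable `[0%R, b] (EFin \o h).
  move=> mh h0 hE; apply/integrableP; split.
    by apply/measurable_EFinP; exact: measurable_funTS.
  rewrite (_ : (\int[P]_(x in _) _ = e%:E)%E) ?ltry// -hE.
  apply: eq_integral => s; rewrite inE/= in_itv => sb.
  by rewrite ger0_norm// h0.
have ix := integ _ _ (@measurable_id _ _ setT) (fun s sb => (andP sb).1) mean.
have ig := integ _ _ mg (fun s _ => normr_ge0 _) dev.
have ic k : P.-integrable `[0%R, b] (EFin \o cst k).
  exact: finite_measure_integrable_cst.
(* On either side of mu, F is the kinked majorant: its slopes are a1 - a2 = alpha
   and a1 + a2 = beta. *)
set a1 := (alpha + beta) / 2; set a2 := (beta - alpha) / 2.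
pose F s := c - a2 * mu + (a1 * s + a2 * g s).
have fF (s : R) : 0 <= s <= b -> f s <= F s.
  move=> /andP[s0 sb]; rewrite /F /g /a1 /a2; case: (leP s mu) => smu.
    rewrite ler0_norm ?subr_le0//.
    have := fl s; rewrite s0 smu => /(_ isT); lra.
  rewrite ger0_norm; last by rewrite subr_ge0 ltW.
  have := fr s; rewrite (ltW smu) sb => /(_ isT); lra.
have FE : (\int[P]_(s in `[0%R, b]) (F s)%:E =
    (c + alpha * mu + (beta - alpha) * (d / 2))%:E)%E.
  under eq_integral => s _.
    rewrite /F EFinD [(a1 * s + _)%:E]EFinD (EFinM a1) (EFinM a2 (g s)).
    over.
  rewrite integralD//=; last 2 first.
    exact: ic.
    by apply: integrableD => //; exact: integrableZl.
  rewrite integralD//=; [|exact: integrableZl..].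
  rewrite !integralZl// integral_cst//= Pb mule1 mean dev.
  by rewrite -!EFinM -!EFinD; congr EFin; rewrite /a1 /a2; field.
rewrite -FE; apply: ge0_le_integral => //.
- by apply/measurable_EFinP; exact: measurable_funTS.
- apply/measurable_EFinP; apply: measurable_funTS.
  by repeat apply: measurable_funD => //; apply: measurable_funM.
Qed.

(** * The payment function *)

Section layer_payment.
Context (R : realType).
Implicit Types m z s : R.

Lemma phiE m z s : 0 <= m -> phi m z s = Num.max 0 (Num.min m (s - z)).
Proof.
move=> m0; rewrite /phi; case: (leP m (s - z)) => ?; case: (leP (z + m) s) => ?;
  case: (leP z s) => ?; case: leP => ?; lra.
Qed.

Lemma measurable_phi m z : 0 <= m ->
  measurable_fun [set: measurableTypeR R] (phi m z).
Proof.
move=> m0; rewrite (_ : phi m z =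
    (fun=> 0) \max ((fun=> m) \min (fun s => s - z))).
  apply: measurable_maxr => //; apply: measurable_minr => //.
  exact: measurable_funB.
by apply/funext => s; rewrite phiE.
Qed.

Lemma phi_ge0 m z s : 0 <= m -> 0 <= phi m z s.
Proof. by move=> m0; rewrite phiE// le_max lexx. Qed.

Lemma phi_lower m z s : 0 <= m -> s <= z -> phi m z s = 0.
Proof.
move=> m0 sz; rewrite /phi.
by case: (leP (z + m) s) => ?; case: (leP z s) => ?; lra.
Qed.

Lemma phi_middle m z s : z <= s <= z + m -> phi m z s = s - z.
Proof.
move=> /andP[zs st]; rewrite /phi.
by case: (leP (z + m) s) => ?; case: (leP z s) => ?; lra.
Qed.

Lemma phi_upper m z s : z + m <= s -> phi m z s = m.
Proof. by rewrite /phi => ->. Qed.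

Lemma phi_le_max m z s : 0 <= m -> phi m z s <= m.
Proof.
move=> m0; rewrite /phi.
by case: (leP (z + m) s) => ?; case: (leP z s) => ?; lra.
Qed.

Lemma phi_le_excess m z s : 0 <= m -> z <= s -> phi m z s <= s - z.
Proof.
move=> m0 zs; rewrite /phi.
by case: (leP (z + m) s) => ?; case: (leP z s) => ?; lra.
Qed.

End layer_payment.

(** * The worst case for each position of the layer *)

Section worst_case_layer.
Context (R : realType) (mu b d m z : R).
Hypotheses (mu_gt0 : 0 < mu) (mu_lt_b : mu < b) (d_ge0 : 0 <= d)
  (d_le : d <= 2 * mu * (b - mu) / b)
  (m_gt0 : 0 < m) (z_ge0 : 0 <= z) (z_le_b : z <= b).

Let params : [/\ 0 < mu, mu < b, 0 < m, 0 <= z & z <= b]. Proof. by []. Qed.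
Let m_ge0 : 0 <= m. Proof. exact: ltW. Qed.
Let b_gt0 : 0 < b. Proof. exact: lt_trans mu_lt_b. Qed.
Let d_scaled : d * b <= 2 * mu * (b - mu).
Proof. by rewrite -ler_pdivlMr. Qed.

(** The mass at 0 of an admissible law carried by {0} and [mu, b]. *)
Let u : R := d / (2 * mu).

Let u_spec : [/\ 0 <= u, u < 1, d = 2 * mu * u & b * u <= b - mu].
Proof.
have [? ? _ _ _] := params.
have u0 : 0 <= u by rewrite divr_ge0// mulr_ge0// ltW.
have du : d = 2 * mu * u by rewrite /u; field; lra.
have bu : b * u <= b - mu.
  rewrite -(ler_pM2l (_ : 0 < 2 * mu)); last lra.
  by rewrite mulrCA -du mulrC.
by split=> //; rewrite -(ltr_pM2l b_gt0); lra.
Qed.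

(** The mass at b of an admissible law carried by [0, mu] and {b}. *)
Let e : R := d / (2 * (b - mu)).

Let e_spec : [/\ 0 <= e, d = 2 * (b - mu) * e & b * e <= mu].
Proof.
have [? ? _ _ _] := params.
have de : d = 2 * (b - mu) * e by rewrite /e; field; lra.
split=> //; first by rewrite divr_ge0// mulr_ge0// subr_ge0 ltW.
rewrite -(ler_pM2l (_ : 0 < 2 * (b - mu))); last lra.
by rewrite mulrCA -de; move: d_scaled; lra.
Qed.

Lemma worst_case_le_max : (worst_case mu b d (phi m z) <= m%:E)%E.
Proof.
have := @worst_case_le_kinked R mu b d (phi m z) m 0 0 (measurable_phi _ m_ge0).
rewrite !mul0r subrr !mul0r !addr0; apply.
- by move=> s _; exact: phi_ge0.
- by move=> s _; rewrite !mul0r addr0; exact: phi_le_max.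
- by move=> s _; rewrite !mul0r !addr0; exact: phi_le_max.
Qed.

(** All nonconstant optimal majorants vanish at 0, where phi does. *)
Lemma worst_case_le_chords (alpha beta : R) :
  (forall s : R, 0 <= s <= mu -> phi m z s <= alpha * s) ->
  (forall s : R, mu <= s <= b -> phi m z s <= alpha * mu + beta * (s - mu)) ->
  (worst_case mu b d (phi m z) <=
    (alpha * mu + (beta - alpha) * (d / 2))%:E)%E.
Proof.
move=> fl fr.
rewrite -[alpha * mu]add0r; apply: worst_case_le_kinked => //.
- exact: measurable_phi.
- by move=> s _; exact: phi_ge0.
- by move=> s; rewrite add0r; exact: fl.
- by move=> s; rewrite add0r; exact: fr.
Qed.

(** The atom that accompanies 0 in the two-point law: mass [1 - u] must carry the
whole mean. *)
Let y : R := mu / (1 - u).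

Let y_spec : [/\ mu <= y, y <= b & (1 - u) * y = mu].
Proof.
have [? ? _ _ _] := params; have [? ? _ ?] := u_spec; rewrite /y; split.
- by rewrite ler_pdivlMr; nra.
- by rewrite ler_pdivrMr; nra.
- by field; lra.
Qed.

Lemma le_worst_case_two_atoms :
  (((1 - u) * phi m z y)%:E <= worst_case mu b d (phi m z))%E.
Proof.
have [? ? ? ? ?] := params; have [? ? du _] := u_spec.
have [? ? yE] := y_spec.
apply: (@le_worst_case_three_atoms R mu b d _ u 0 (1 - u) 0 0 y) => //; try lra.
- exact: measurable_phi.
- by move=> s _; exact: phi_ge0.
- by rewrite (phi_lower _ z_ge0)//; lra.
Qed.

(** Let t = z + m. The second bound is optimal as long as the law on {0, t, b}
has nonnegative mass at 0; otherwise some admissible law lives on {t, mu, b},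
where the payment is constantly m. *)
Lemma worst_case_layer_below : z + m <= mu ->
  worst_case mu b d (phi m z) = (Num.min m (m / (m + z) *
    (mu - d * (b - (m + z)) / (2 * (b - mu)))))%:E.
Proof.
move=> t_le; have [? ? ? ? ?] := params; have [? de be] := e_spec.
have -> : d * (b - (m + z)) / (2 * (b - mu)) = e * (b - (z + m)).
  by rewrite /e; field; lra.
rewrite (addrC m z); set t := z + m.
have t_gt0 : 0 < t by rewrite /t; lra.
have tmu : t <= mu by [].
apply/eqP; rewrite eq_le; apply/andP; split.
  rewrite minEle; case: ifPn => _; first exact: worst_case_le_max.
  have -> : m / t * (mu - e * (b - t)) =
      m / t * mu + ((m - m / t * mu) / (b - mu) - m / t) * (d / 2).
    by rewrite de; field; lra.
  apply: worst_case_le_chords => s /andP[sl sr].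
  - rewrite mulrAC ler_pdivlMr//; rewrite /phi -/t.
    case: (leP t s) => st; first by rewrite ler_pM2l.
    case: (leP z s) => zs; last by rewrite mul0r mulr_ge0.
    have : 0 <= z * (t - s) by rewrite mulr_ge0//; lra.
    by rewrite /t; lra.
  - apply: le_trans (phi_le_max _ _ m_ge0) _.
    rewrite -subr_ge0.
    have -> : m / t * mu + (m - m / t * mu) / (b - mu) * (s - mu) - m =
      (m * ((mu - t) * (b - s))) / (t * (b - mu)) by field; lra.
    rewrite divr_ge0// !mulr_ge0//; lra.
have [A|A] := leP (mu - e * (b - t)) t.
(* The mass at t of the law on {0, t, b}, given by the mean constraint. *)
- set q := (mu - b * e) / t.
  have q0 : 0 <= q by rewrite divr_ge0//; lra.
  have qt : q * t = mu - b * e by rewrite /q divfK//; lra.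
  have q1 : q + e <= 1 by rewrite -(ler_pM2r t_gt0); lra.
  apply: (le_worst_case_three_atoms (p := 1 - q - e) (q := q) (r := e)
    (x := 0) (y := t) (w := b)) => //; try lra.
  + exact: measurable_phi.
  + by move=> s _; exact: phi_ge0.
  + rewrite (phi_lower _ z_ge0)// !phi_upper//; last by rewrite -/t; lra.
    rewrite ge_min; apply/orP; right.
    rewrite (_ : m / t * _ = m * q + m * e); first lra.
    by rewrite /q; field; lra.
(* Masses r at t and e at b balance each other around the mean. *)
- set r := e * (b - mu) / (mu - t).
  have muBt : 0 < mu - t.
    have : 0 <= e * (b - t) by rewrite mulr_ge0//; lra.
    lra.
  have r0 : 0 <= r by apply: divr_ge0; [apply: mulr_ge0|]; lra.
  have rt : r * (mu - t) = e * (b - mu) by rewrite /r divfK//; lra.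
  have r1 : r + e <= 1 by rewrite -(ler_pM2r muBt); lra.
  apply: (le_worst_case_three_atoms (p := r) (q := 1 - r - e) (r := e)
    (x := t) (y := mu) (w := b)) => //; try lra.
  + exact: measurable_phi.
  + by move=> s _; exact: phi_ge0.
  + by rewrite !phi_upper -/t; [rewrite ge_min; apply/orP; left|..]; lra.
Qed.

(** The majorant is the line from (0, 0) to (mu, m), then the constant m. On
[z, mu] the line dominates s - z, since it does so at both ends: its values
m z / mu and m are at least 0 and mu - z; below z nothing is paid. *)
Lemma worst_case_le_cap : mu <= z + m ->
  (worst_case mu b d (phi m z) <= (m * (1 - u))%:E)%E.
Proof.
move=> tmu; have [? ? ? ? ?] := params; have [_ _ du _] := u_spec.
rewrite (_ : m * (1 - u) = m / mu * mu + (0 - m / mu) * (d / 2)); last first.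
  by rewrite du; field; lra.
apply: worst_case_le_chords => s /andP[sl sr].
- rewrite mulrAC ler_pdivlMr//.
  have [zs|sz] := leP z s; last by rewrite phi_lower ?mul0r ?mulr_ge0// ltW.
  have := @phi_le_excess _ m z s m_ge0 zs; rewrite -(ler_pM2r mu_gt0).
  move/le_trans; apply.
  (* m s - (s - z) mu = z (mu - s) + (z + m - mu) s *)
  have : 0 <= z * (mu - s) by rewrite mulr_ge0//; lra.
  have : 0 <= (z + m - mu) * s by rewrite mulr_ge0//; lra.
  lra.
- by rewrite mul0r addr0 divfK ?phi_le_max//; lra.
Qed.

(** The majorant is the line from (0, 0) to (mu, mu - z), which dominates the
convex function (s - z)^+ on [0, mu] as its chord, then s - z itself. *)
Lemma worst_case_le_excess : z <= mu ->
  (worst_case mu b d (phi m z) <= (z * (u - 1) + mu)%:E)%E.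
Proof.
move=> zmu; have [? ? ? ? ?] := params; have [_ _ du _] := u_spec.
rewrite (_ : z * (u - 1) + mu =
    (mu - z) / mu * mu + (1 - (mu - z) / mu) * (d / 2)); last first.
  by rewrite du; field; lra.
apply: worst_case_le_chords => s /andP[sl sr].
- rewrite mulrAC ler_pdivlMr//.
  have [zs|sz] := leP z s; last first.
    by rewrite phi_lower ?mul0r ?mulr_ge0 ?subr_ge0// ltW.
  have := @phi_le_excess _ m z s m_ge0 zs; rewrite -(ler_pM2r mu_gt0).
  move/le_trans; apply.
  (* (mu - z) s - (s - z) mu = z (mu - s) *)
  have : 0 <= z * (mu - s) by rewrite mulr_ge0//; lra.
  lra.
- apply: le_trans (@phi_le_excess _ m z s m_ge0 _) _; first lra.
  by rewrite divfK; lra.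
Qed.

Lemma worst_case_le_right_chord (beta : R) : mu <= z ->
  (forall s : R, mu <= s <= b -> phi m z s <= beta * (s - mu)) ->
  (worst_case mu b d (phi m z) <= (beta * (d / 2))%:E)%E.
Proof.
move=> muz fr.
rewrite (_ : beta * (d / 2) = 0 * mu + (beta - 0) * (d / 2)); last by ring.
apply: worst_case_le_chords => s sI; last by rewrite mul0r add0r fr.
by rewrite mul0r phi_lower//; case/andP: sI; lra.
Qed.

(** The two-point law attains both bounds: phi(y) is m or y - z, whichever is
smaller. *)
Lemma worst_case_layer_across : z <= mu <= z + m ->
  worst_case mu b d (phi m z) =
  (Num.min (m * (1 - u)) (z * (u - 1) + mu))%:E.
Proof.
move=> /andP[zmu tmu].
have [? ? ? ? ?] := params; have [? ? du _] := u_spec.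
have [muy yb yE] := y_spec.
apply/eqP; rewrite eq_le; apply/andP; split.
  rewrite minEle; case: ifPn => _.
    exact: worst_case_le_cap.
  exact: worst_case_le_excess.
apply: le_trans le_worst_case_two_atoms; rewrite lee_fin.
have [ty|yt] := leP (z + m) y.
- by rewrite phi_upper// mulrC ge_min lexx.
- by rewrite phi_middle ?ge_min; [apply/orP; right|]; lra.
Qed.

(** The two-point law is optimal if y reaches the end of the layer. Otherwise the
mass at y is spread over mu, where nothing is paid, and z + m, where the whole
of m is paid; y < z + m makes the mass left at mu nonnegative. *)
Lemma worst_case_layer_above : mu <= z ->
  z + m <= b ->
  worst_case mu b d (phi m z) =
  (Num.min (m * (1 - u)) (d * m / (2 * (m + z - mu))))%:E.
Proof.
move=> muz tb; have [? ? ? ? ?] := params; have [? ? du _] := u_spec.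
have [muy yb yE] := y_spec.
have w_gt0 : 0 < m + z - mu by lra.
apply/eqP; rewrite eq_le; apply/andP; split.
  rewrite minEle; case: ifPn => _; first by apply: worst_case_le_cap; lra.
  rewrite (_ : d * m / _ = m / (m + z - mu) * (d / 2)); last by field; lra.
  apply: worst_case_le_right_chord => // s /andP[mus sb].
  rewrite mulrAC ler_pdivlMr//.
  have [zs|sz] := leP z s; last first.
    by rewrite phi_lower ?mul0r ?mulr_ge0 ?subr_ge0// ltW.
  have [st|ts] := leP s (z + m).
    rewrite phi_middle ?zs//.
    (* m (s - mu) - (s - z) (m + z - mu) = (z - mu) (z + m - s) *)
    have : 0 <= (z - mu) * (z + m - s) by rewrite mulr_ge0//; lra.
    lra.
  by rewrite phi_upper ?ler_pM2l; lra.
have [ty|yt] := leP (z + m) y.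
  apply: le_trans le_worst_case_two_atoms; rewrite lee_fin.
  by rewrite phi_upper// mulrC ge_min lexx.
set r := d / (2 * (m + z - mu)).
have r0 : 0 <= r by apply: divr_ge0 => //; lra.
have rt : r * (m + z - mu) = mu * u by rewrite /r du; field; lra.
have r1 : u + r <= 1.
  rewrite -(ler_pM2r w_gt0) mulrDl rt.
  have : (1 - u) * y <= (1 - u) * (z + m) by rewrite ler_pM2l; lra.
  lra.
apply: (le_worst_case_three_atoms (p := u) (q := 1 - u - r) (r := r)
  (x := 0) (y := mu) (w := z + m)) => //; try lra.
- exact: measurable_phi.
- by move=> s _; exact: phi_ge0.
- rewrite (phi_lower _ z_ge0)// (phi_lower _ muz)// phi_upper//.
  rewrite ge_min; apply/orP; right.
  by rewrite (_ : d * m / _ = r * m); [lra|rewrite /r; field; lra].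
Qed.

Lemma worst_case_excess_across : b < z + m -> z <= mu ->
  worst_case mu b d (phi m z) = (z * (u - 1) + mu)%:E.
Proof.
move=> bt zmu; have [? ? ? ? ?] := params; have [muy yb yE] := y_spec.
apply/eqP; rewrite eq_le worst_case_le_excess//=.
apply: le_trans le_worst_case_two_atoms; rewrite lee_fin.
by rewrite phi_middle; lra.
Qed.

(** On [mu, b] the payment is the convex function (s - z)^+, bounded by its chord
and equal to it at mu and b; hence atoms at 0, mu and b. *)
Lemma worst_case_excess_above : b < z + m -> mu <= z ->
  worst_case mu b d (phi m z) = (d * (b - z) / (2 * (b - mu)))%:E.
Proof.
move=> bt muz; have [? ? ? ? ?] := params.
have [? ? du bu] := u_spec; have [? de be] := e_spec.
apply/eqP; rewrite eq_le; apply/andP; split.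
  rewrite (_ : _ / _ = (b - z) / (b - mu) * (d / 2)); last by field; lra.
  apply: worst_case_le_right_chord => // s /andP[mus sb].
  rewrite mulrAC ler_pdivlMr ?subr_gt0//.
  have [zs|sz] := leP z s; last first.
    by rewrite phi_lower ?mul0r ?mulr_ge0 ?subr_ge0// ltW.
  rewrite phi_middle; last by lra.
  (* (b - z) (s - mu) - (s - z) (b - mu) = (z - mu) (b - s) *)
  have : 0 <= (z - mu) * (b - s) by rewrite mulr_ge0//; lra.
  lra.
have ue : u + e <= 1 by rewrite -(ler_pM2l b_gt0); lra.
apply: (le_worst_case_three_atoms (p := u) (q := 1 - u - e) (r := e)
  (x := 0) (y := mu) (w := b)) => //; try lra.
- exact: measurable_phi.
- by move=> s _; exact: phi_ge0.
- rewrite (phi_lower _ z_ge0)// (phi_lower _ muz)// phi_middle; last lra.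
  by rewrite (_ : _ / _ = e * (b - z)); [lra|rewrite /e; field; lra].
Qed.

End worst_case_layer.

Theorem theorem7 (R : realType) (mu b d m z : R)
  (mu_gt0 : 0 < mu) (mu_lt_b : mu < b)
  (d_ge0 : 0 <= d) (d_le : d <= 2 * mu * (b - mu) / b)
  (m_gt0 : 0 < m) (z_ge0 : 0 <= z) (z_le_b : z <= b) :
  (z + m <= b ->
    [/\ z <= m + z <= mu ->
          worst_case mu b d (phi m z) =
          (Num.min m (m / (m + z) *
             (mu - d * (b - (m + z)) / (2 * (b - mu)))))%:E,
        z <= mu <= z + m ->
          worst_case mu b d (phi m z) =
          (Num.min (m * (1 - d / (2 * mu)))
                   (z * (d / (2 * mu) - 1) + mu))%:E
      & mu <= z <= z + m ->
          worst_case mu b d (phi m z) =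
          (Num.min (m * (1 - d / (2 * mu)))
                   (d * m / (2 * (m + z - mu))))%:E]) /\
  (b < z + m ->
    [/\ forall s : R, 0 <= s <= b -> phi m z s = Num.max (s - z) 0,
        z <= mu ->
          worst_case mu b d (phi m z) = (z * (d / (2 * mu) - 1) + mu)%:E
      & mu <= z ->
          worst_case mu b d (phi m z) = (d * (b - z) / (2 * (b - mu)))%:E]).
Proof.
split=> [tb|bt]; split.
- by move=> /andP[_ tmu]; apply: worst_case_layer_below => //; rewrite addrC.
- by move=> zmut; exact: worst_case_layer_across.
- by move=> /andP[muz _]; exact: worst_case_layer_above.
- move=> s /andP[s0 sb]; rewrite maxC maxEle subr_ge0 /phi leNgt.
  by rewrite (le_lt_trans sb bt).
- by move=> zmu; exact: worst_case_excess_across.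
- by move=> muz; exact: worst_case_excess_above.
Qed.
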